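(* Let $f\colon\mathbb{B}^n\to\mathbb{B}^n$ be a Boolean network with set of components $V$, and suppose $V$ is the disjoint union of sets $U_1,U_2,W$ and a vertex $v$ such that the edges of the interaction graph $G(f)$ are only of the following kinds: edges inside $U_1$, inside $U_2$, or inside $W$ (arbitrary); edges from $U_1$ to $U_2$ (possibly none); edges from $U_1$ to $W$ (possibly none); edges from $U_2$ to $v$ (at least one); edges from $v$ to $W$ (at least one); and possibly a loop at $v$, which if present is negative (there is no positive loop at $v$). Then the attractors of $f$ are preserved by the elimination of $v$, that is: (i) for each attractor $A$ of $AD(f)$, $\pi(A)$ is an attractor of $AD(\tilde f)$; and (ii) for each attractor $\tilde A$ of $AD(\tilde f)$ there exists a unique attractor $A$ of $AD(f)$ such that $\pi(A)=\tilde A$.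
   Context: $\mathbb{B}=\{0,1\}$. A Boolean network is a map $f\colon\mathbb{B}^n\to\mathbb{B}^n$ with components $V=\{1,\dots,n\}$. $\bar{x}^i$ denotes $x$ with component $i$ flipped; $x^{i=a}$ denotes $x$ with component $i$ set to $a$. The asynchronous dynamics $AD(f)$ is the directed graph on $\mathbb{B}^n$ with a transition $x\to\bar{x}^i$ iff $f_i(x)\neq x_i$. The interaction graph $G(f)$ is the signed multidigraph on $V$ with an edge $j\to i$ of sign $s\in\{-1,1\}$ iff $s=(f_i(\bar{x}^j)-f_i(x))(\bar{x}^j_j-x_j)$ for some $x\in\mathbb{B}^n$; a loop is an edge $v\to v$, negative/positive according to its sign. A trap set is a set of states closed under transitions of the asynchronous dynamics; attractors are the minimal nonempty trap sets. Elimination of $v$ (no positive loop at $v$): for $a\in\{0,1\}$, $\mathcal{R}^a(x)=(x_1,\dots,x_{v-1},f_v(x^{v=a}),x_{v+1},\dots,x_n)$; $\pi\colon\mathbb{B}^n\to\mathbb{B}^{n-1}$ is the projection onto components $V\setminus\{v\}$; $\mathcal{S}^a$ is the unique map with $\mathcal{S}^a\circ\pi=\mathcal{R}^a$; $\tilde f\colon\mathbb{B}^{n-1}\to\mathbb{B}^{n-1}$, $\tilde f_i(x)=f_i(\mathcal{S}^0(x))\wedge f_i(\mathcal{S}^1(x))$ if $x_i=1$ and $\tilde f_i(x)=f_i(\mathcal{S}^0(x))\vee f_i(\mathcal{S}^1(x))$ if $x_i=0$, for $i\neq v$. *)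

(* Defs.v *)
From mathcomp Require Import all_boot all_order all_algebra.
Set Implicit Arguments. Unset Strict Implicit. Unset Printing Implicit Defensive.
Import GRing.Theory.

Notation state n := {ffun 'I_n -> bool}.

Definition setc n (x : state n) (v : 'I_n) (a : bool) : state n :=
  [ffun i => if i == v then a else x i].

Definition flip n (x : state n) (i : 'I_n) : state n := setc x i (~~ x i).

Definition async n (f : state n -> state n) : rel (state n) :=
  [rel x y | [exists i, (f x i != x i) && (y == flip x i)]].

Definition trap_set n (f : state n -> state n) (A : {set state n}) : bool :=
  [forall x in A, forall y, async f x y ==> (y \in A)].

Definition attractor n (f : state n -> state n) (A : {set state n}) : bool :=
  minset (fun B : {set state n} => (B != set0) && trap_set f B) A.

Definition edge n (f : state n -> state n) (s : int) (j i : 'I_n) : bool :=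
  (s \in [:: -1; 1]%R) &&
  [exists x : state n,
     s == ((f (flip x j) i)%:Z - (f x i)%:Z) * ((flip x j j)%:Z - (x j)%:Z)]%R.

Definition proj n (v : 'I_n) (x : state n) : state n.-1 :=
  [ffun j => x (lift v j)].

Definition insert n (v : 'I_n) (a : bool) (y : state n.-1) : state n :=
  [ffun i => if unlift v i is Some j then y j else a].

Definition elimR n (f : state n -> state n) (v : 'I_n) (a : bool)
  (x : state n) : state n := setc x v (f (setc x v a) v).

(* elimR f v a x does not depend on x v, so any section of proj v can be used
   here; elimS_proj and elimS_unique are the characterization of this map. *)
Definition elimS n (f : state n -> state n) (v : 'I_n) (a : bool)
  (y : state n.-1) : state n := elimR f v a (insert v a y).

(* Elimination is meant for v without a positive loop; the formula is total. *)
Definition elim_network n (f : state n -> state n) (v : 'I_n)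
  (y : state n.-1) : state n.-1 :=
  [ffun i => let b0 := f (elimS f v false y) (lift v i) in
             let b1 := f (elimS f v true y) (lift v i) in
             if y i then b0 && b1 else b0 || b1].

Lemma insertK n (v : 'I_n) a : cancel (insert v a) (proj v).
Proof. by move=> y; apply/ffunP=> j; rewrite !ffunE liftK. Qed.

Lemma setc_insert_proj n (v : 'I_n) a b (x : state n) :
  setc (insert v a (proj v x)) v b = setc x v b.
Proof.
apply/ffunP=> i; rewrite !ffunE; case: unliftP => [j ->|->]; last by rewrite eqxx.
by rewrite ffunE.
Qed.

Lemma elimS_proj n (f : state n -> state n) v a (x : state n) :
  elimS f v a (proj v x) = elimR f v a x.
Proof. by rewrite /elimS /elimR !setc_insert_proj. Qed.

Lemma elimS_unique n (f : state n -> state n) v a (S : state n.-1 -> state n) :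
  (forall x, S (proj v x) = elimR f v a x) -> S =1 elimS f v a.
Proof. by move=> S_proj y; rewrite -(insertK v a y) S_proj elimS_proj. Qed.

(* Main.v *)
(** Write [E] for the asynchronous dynamics of the reduced network and call a
    value [w] admissible at [y] when [f v] can produce [w] over [y].  Without a
    positive loop at [v], a state of [f] over [y] can always set [v] to any
    admissible value, so [E]-transitions lift to paths of [f] and trap sets of
    [f] project to trap sets of [E].  The only transitions of [f] missing from
    [E] update [W] while [v] holds an outdated value.  Given an attractor [A'] of
    [E], let [B] be the set of states over [A'] whose [v] is admissible somewhere
    in [A'].  Then [B] is a trap set of [f]: to simulate an outdated update of [W]
    with value [w], move [U1] and [U2] inside [A'], with [W] frozen, to a point
    where [w] is admissible, move [U1] back with [U2] frozen, update [W] (which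
    depends on [U2] only through [v]), and move [U1] and [U2] back.  An attractor
    [A] of [f] with [proj v @: A] meeting [A'] also meets [B], hence lies in
    [B], and contains every admissible lift of a point of [A']. *)
Require Import Defs.
From mathcomp Require Import all_boot all_order all_algebra.
Set Implicit Arguments. Unset Strict Implicit. Unset Printing Implicit Defensive.

(** * Trap sets and attractors of an arbitrary asynchronous dynamics *)

Section TrapSets.
Variables (n : nat) (g : state n -> state n).
Implicit Types (A B : {set state n}) (x y : state n).

Lemma asyncP x y :
  reflect (exists2 i, g x i != x i & y = flip x i) (async g x y).
Proof.
apply: (iffP existsP) => [[i /andP[gi /eqP->]]|[i gi ->]]; first by exists i.
by exists i; rewrite gi eqxx.
Qed.

Lemma trap_setP A :
  reflect (forall x y, x \in A -> async g x y -> y \in A) (trap_set g A).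
Proof.
apply: (iffP forall_inP) => [tA x y xA xy|tA x xA].
  by have /forallP/(_ y)/implyP := tA x xA; apply.
by apply/forallP=> y; apply/implyP; apply: tA.
Qed.

Lemma trap_connect A x y :
  trap_set g A -> x \in A -> connect (async g) x y -> y \in A.
Proof.
move=> /trap_setP tA + /connectP[p + ->].
elim: p x => [//|z p IHp] x xA /= /andP[xz]; apply: IHp.
exact: tA xz.
Qed.

Lemma trap_setI A B : trap_set g A -> trap_set g B -> trap_set g (A :&: B).
Proof.
move=> /trap_setP tA /trap_setP tB; apply/trap_setP=> x y /setIP[xA xB] xy.
by apply/setIP; split; [apply: tA xy | apply: tB xy].
Qed.

Lemma trap_reachable x : trap_set g [set y | connect (async g) x y].
Proof.
apply/trap_setP=> y z; rewrite !inE => xy yz.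
exact: connect_trans xy (connect1 yz).
Qed.

Lemma attractor_trap A : attractor g A -> trap_set g A.
Proof. by case/minsetP=> /andP[]. Qed.

Lemma attractor_nonempty A : attractor g A -> exists x, x \in A.
Proof. by case/minsetP=> /andP[/set0Pn]. Qed.

(** [A :&: B] is a nonempty trap set inside [A], so minimality makes it all of [A]. *)
Lemma attractor_sub A B x :
  attractor g A -> trap_set g B -> x \in A -> x \in B -> A \subset B.
Proof.
move=> attA tB xA xB; have tA := attractor_trap attA.
have [_ minA] := minsetP attA.
rewrite -(minA (A :&: B)) ?subsetIl ?subsetIr // trap_setI // andbT.
by apply/set0Pn; exists x; rewrite inE xA.
Qed.

Lemma attractor_connect A x y :
  attractor g A -> x \in A -> y \in A -> connect (async g) x y.
Proof.
move=> attA xA yA.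
have xx : x \in [set z | connect (async g) x z] by rewrite inE.
have /subsetP/(_ y yA) := attractor_sub attA (trap_reachable x) xA xx.
by rewrite inE.
Qed.

Lemma attractor_exists B x :
  trap_set g B -> x \in B -> exists2 A, attractor g A & A \subset B.
Proof.
move=> tB xB; case: (@minset_exists _ (fun C => (C != set0) && trap_set g C) B).
  by rewrite tB andbT; apply/set0Pn; exists x.
by move=> A attA sAB; exists A.
Qed.

End TrapSets.

(** * Missing edges as independence of a component *)

Section Dependency.
Variables (n : nat) (f : state n -> state n).
Implicit Types (x y : state n) (i j v : 'I_n).

Lemma no_edge_setc x i j a :
  (forall s, ~~ edge f s j i) -> f (setc x j a) i = f x i.
Proof.
move=> noE; have [eqa|neqa] := eqVneq a (x j).
  by congr (f _ i); apply/ffunP=> k; rewrite ffunE; case: eqP => // ->.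
have -> : setc x j a = flip x j.
  by rewrite /flip; congr setc; case: a (x j) neqa => [] [].
apply/eqP; apply: contraT => neqf.
pose s := (((f (flip x j) i)%:Z - (f x i)%:Z) * ((flip x j j)%:Z - (x j)%:Z))%R.
have /negP[] := noE s; rewrite /edge; apply/andP; split; last first.
  by apply/existsP; exists x.
rewrite /s !ffunE eqxx; move: neqf.
by case: (f _ i) (f x i) (x j) => [] [] [].
Qed.

(** Overwrite the differing components of [x] by those of [y] one at a time; none of them influences
    [i]. *)
Lemma eq_component x y i :
  (forall j, x j != y j -> forall s, ~~ edge f s j i) -> f x i = f y i.
Proof.
have [m] := ubnP #|[set j | x j != y j]|.
elim: m x => // m IHm x; rewrite ltnS => le_m noE.
have [d0|[j]] := set_0Vmem [set j | x j != y j].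
  congr (f _ i); apply/ffunP=> j; apply/eqP; apply: contraT => neq.
  by have := in_set0 j; rewrite -d0 inE neq.
rewrite inE => neqj; rewrite -(@no_edge_setc x i j (y j)); last exact: noE.
have setcE k : (setc x j (y j) k != y k) = (k != j) && (x k != y k).
  by rewrite ffunE; case: (eqVneq k j) => [->|] //; rewrite eqxx.
apply: IHm => [|k]; last by rewrite setcE => /andP[_]; apply: noE.
apply: leq_trans le_m; apply: proper_card; apply/properP; split.
  by apply/subsetP=> k; rewrite !inE setcE => /andP[].
by exists j; rewrite !inE ?setcE ?eqxx.
Qed.

(** Otherwise [f v] would follow the flip of [v], and both differences in the sign of the loop would
    agree. *)
Lemma no_positive_loop x v :
  ~~ edge f 1%R v v -> f x v = x v -> f (flip x v) v = x v.
Proof.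
move=> noloop fx; apply/eqP; apply: contraNT noloop => neqf.
rewrite /edge; apply/andP; split=> //; apply/existsP; exists x.
rewrite fx !ffunE eqxx; move: neqf.
by case: (f _ v) (x v) => [] [].
Qed.

End Dependency.

(** * Transitions of the reduced network and their lifts *)

Section Elimination.
Variables (n : nat) (f : state n -> state n) (v : 'I_n).
Implicit Types (y z t : state n.-1) (i : 'I_n.-1) (S : {set 'I_n}).
Local Notation E := (async (elim_network f v)).

Lemma insert_lift a y i : insert v a y (lift v i) = y i.
Proof. by rewrite ffunE liftK. Qed.

Lemma insert_v a y : insert v a y v = a.
Proof. by rewrite ffunE unlift_none. Qed.

Lemma insert_proj (x : state n) : insert v (x v) (proj v x) = x.
Proof. by apply/ffunP=> j; rewrite ffunE; case: unliftP => [i ->|->]; rewrite ?ffunE. Qed.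

Lemma flip_insert_v a y : flip (insert v a y) v = insert v (~~ a) y.
Proof.
apply/ffunP=> j; rewrite ffunE insert_v.
case: (unliftP v j) => [i ->|->]; last by rewrite eqxx insert_v.
by rewrite eq_sym (negPf (neq_lift v i)) !insert_lift.
Qed.

Lemma flip_insert_lift a y i :
  flip (insert v a y) (lift v i) = insert v a (flip y i).
Proof.
apply/ffunP=> j; rewrite ffunE insert_lift.
case: (unliftP v j) => [k ->|->]; last by rewrite (negPf (neq_lift v i)) !insert_v.
by rewrite (inj_eq lift_inj) !insert_lift ffunE.
Qed.

Definition admissible y (w : bool) := [exists a, f (insert v a y) v == w].

Lemma admissible_f a y : admissible y (f (insert v a y) v).
Proof. by apply/existsP; exists a. Qed.

(** The two maps [elimS] insert exactly the admissible values at [y], and the and/or formula changes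
    [y i] as soon as one of them does. *)
Lemma async_elimP y z :
  reflect (exists i w, [/\ admissible y w, f (insert v w y) (lift v i) != y i
                         & z = flip y i])
          (E y z).
Proof.
have elimSE a : elimS f v a y = insert v (f (insert v a y) v) y.
  rewrite -{1}(insertK v a y) elimS_proj /elimR.
  apply/ffunP=> j; rewrite ffunE.
  have -> : setc (insert v a y) v a = insert v a y.
    by apply/ffunP=> k; rewrite !ffunE; case: unliftP => [l ->|->]; rewrite ?eqxx //;
       rewrite eq_sym (negPf (neq_lift v l)).
  case: (unliftP v j) => [k ->|->]; last by rewrite eqxx insert_v.
  by rewrite eq_sym (negPf (neq_lift v k)) !insert_lift.
apply: (iffP (asyncP _ _ _)) => [[i + ->]|[i [w [/existsP[a /eqP<-] neq ->]]]].
  rewrite ffunE !elimSE => neq; exists i.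
  have [neq0|eq0] :=
    boolP (f (insert v (f (insert v false y) v) y) (lift v i) != y i).
    by exists (f (insert v false y) v); rewrite admissible_f.
  exists (f (insert v true y) v); rewrite admissible_f; split=> //.
  by move: neq eq0; case: (y i) (f _ _) (f (insert v _ y) _) => [] [] [].
exists i => //; rewrite ffunE !elimSE.
by case: a neq; case: (y i) (f _ _) (f (insert v _ y) _) => [] [] [].
Qed.

Hypothesis noloop : ~~ edge f 1%R v v.

(** Suppose [v] has value [b] other than [w]. If [a = b], updating [v] yields [w]. Otherwise
    [a = w], so [v] is stable at [w], and without a positive loop it is also driven to [w] from
    [b]. *)
Lemma trap_admissible (A : {set state n}) y w :
  trap_set f A -> y \in proj v @: A -> admissible y w -> insert v w y \in A.
Proof.
move=> /trap_setP tA /imsetP[x xA ->] /existsP[a /eqP fa].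
move: xA; rewrite -{1}(insert_proj x); move: (proj v x) (x v) fa => {x}y b fa yA.
have [<- //|neq] := eqVneq b w.
apply: tA yA _; apply/asyncP; exists v; last first.
  by rewrite flip_insert_v; congr insert; case: b w neq {fa} => [] [].
rewrite insert_v; suff -> : f (insert v b y) v = w by rewrite eq_sym.
have [<- //|neqa] := eqVneq a b.
have eqa : a = w by case: a b w neq neqa {fa} => [] [] [].
have := @no_positive_loop _ f (insert v a y) v noloop.
rewrite insert_v fa flip_insert_v eqa => /(_ erefl) <-.
by congr (f (insert v _ y) v); case: b w neq {neqa fa eqa} => [] [].
Qed.

Lemma trap_proj (A : {set state n}) :
  trap_set f A -> trap_set (elim_network f v) (proj v @: A).
Proof.
move=> tA; apply/trap_setP=> y z yA /async_elimP[i [w [adm neq ->]]].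
have ywA := trap_admissible tA yA adm.
rewrite -(insertK v w (flip y i)); apply: imset_f.
move/trap_setP: tA; apply; first exact: ywA.
by apply/asyncP; exists (lift v i); rewrite ?insert_lift ?flip_insert_lift.
Qed.

(** Both attractors contain the same admissible lift of a common projected point. *)
Lemma attractor_proj_inj (A B : {set state n}) :
  attractor f A -> attractor f B -> proj v @: A = proj v @: B -> A = B.
Proof.
move=> attA attB eqAB; have [tA tB] := (attractor_trap attA, attractor_trap attB).
have [x xA] := attractor_nonempty attA; have xpA := imset_f (proj v) xA.
have adm := admissible_f false (proj v x).
have yA := trap_admissible tA xpA adm.
rewrite eqAB in xpA; have yB := trap_admissible tB xpA adm.
by apply/eqP; rewrite eqEsubset (attractor_sub attA tB yA) ?(attractor_sub attB tA yB).
Qed.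

(** * Replaying paths on a closed set of components *)

Definition mix S y t : state n.-1 :=
  [ffun i => if lift v i \in S then y i else t i].

Lemma mix_id S y : mix S y y = y.
Proof. by apply/ffunP=> i; rewrite ffunE if_same. Qed.

Lemma mix_flip S y t i :
  lift v i \notin S -> mix S y (flip t i) = flip (mix S y t) i.
Proof.
move=> iS; apply/ffunP=> k; rewrite !ffunE (negPf iS).
by case: eqP => // ->; rewrite (negPf iS).
Qed.

(** Components in [S] read only [S], so their updates stay possible whatever the rest holds; the
    other updates of the path are skipped. *)
Lemma connect_mix S y z t :
    (forall s (j i : 'I_n), edge f s j i -> i \in S -> j \in S) -> v \notin S ->
  connect E y z -> connect E (mix S y t) (mix S z t).
Proof.
move=> closedS vS /connectP[p + ->]; elim: p y => [|u p IHp] y /=.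
  by move=> _; apply: connect0.
case/andP=> /async_elimP[i [w [_ neq ->]]] /IHp; apply: connect_trans.
have [iS|iS] := boolP (lift v i \in S); last first.
  suff -> : mix S (flip y i) t = mix S y t by apply: connect0.
  apply/ffunP=> k; rewrite !ffunE; case: ifP => // kS.
  by case: eqP kS iS => // -> ->.
apply/connect1/async_elimP; exists i.
(* Any admissible value serves, since components in [S] do not read [v]. *)
exists (f (insert v false (mix S y t)) v); rewrite admissible_f; split=> //.
  rewrite ffunE iS; apply: contraNneq neq => <-; apply/eqP/eq_component => j.
  move=> neqj s; apply: contra neqj => /closedS/(_ iS) jS.
  case: (unliftP v j) jS => [k -> kS|->]; last by rewrite (negPf vS).
  by rewrite !insert_lift ffunE kS.
apply/ffunP=> k; rewrite !ffunE iS.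
by case: eqP => // ->; rewrite iS.
Qed.

(** * Attractors under the block structure *)

Variables U1 U2 : {set 'I_n}.
Local Notation U := (U1 :|: U2).
Hypotheses (vU : v \notin U) (disjU : [disjoint U1 & U2]).
Hypothesis closedU1 : forall s (j i : 'I_n), edge f s j i -> i \in U1 -> j \in U1.
Hypothesis closedU : forall s (j i : 'I_n), edge f s j i -> i \in U -> j \in U.
Hypothesis into_v : forall s j, edge f s j v -> j \in U2 \/ j = v.
Hypothesis from_U2 : forall s (j i : 'I_n),
  edge f s j i -> j \in U2 -> i \notin U -> i = v.

Lemma connect_outdated A' x y w i :
    attractor (elim_network f v) A' -> x \in A' -> y \in A' ->
    admissible y w -> lift v i \notin U -> f (insert v w x) (lift v i) != x i ->
  connect E x (flip x i).
Proof.
move=> attA xA yA adm iU neq.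
have [xy yx] := (attractor_connect attA xA yA, attractor_connect attA yA xA).
have vU1 : v \notin U1 by apply: contra vU => vU1; rewrite inE vU1.
(* [p2] agrees with [y] on [U2] and with [x] elsewhere. *)
pose p1 := mix U y x; pose p2 := mix U1 x p1.
have xp1 : connect E x p1 by rewrite -{1}(mix_id U x); apply: connect_mix.
have p1p2 : connect E p1 p2.
  suff -> : p1 = mix U1 y p1 by apply: connect_mix.
  by apply/ffunP=> k; rewrite !ffunE inE; case: (lift v k \in U1).
have xp2 := connect_trans xp1 p1p2.
have p2U2 k : lift v k \in U2 -> p2 k = y k.
  move=> kU2; rewrite !ffunE inE kU2 orbT.
  by rewrite (disjointFl disjU kU2).
have p2NU2 k : lift v k \notin U2 -> p2 k = x k.
  move=> kU2; rewrite !ffunE inE (negPf kU2) orbF.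
  by case: (lift v k \in U1).
have p2i : p2 i = x i.
  by apply: p2NU2; apply: contra iU => iU2; rewrite inE iU2 orbT.
have p2p3 : connect E p2 (flip p2 i).
  apply/connect1/async_elimP; exists i, w; split=> //.
    (* [f v] reads only [U2] and [v], so [w] is admissible at [p2] as it is at [y]. *)
    have [a /eqP fa] := existsP adm; apply/existsP; exists a; rewrite -fa.
    apply/eqP/eq_component => j neqj s; apply: contra neqj.
    case/into_v => [|->]; last by rewrite !insert_v.
    case: (unliftP v j) => [k ->|->]; last by rewrite !insert_v.
    by rewrite !insert_lift => /p2U2 ->.
  rewrite p2i; apply: contraNneq neq => <-; apply/eqP/eq_component => j neqj s.
  apply: contra neqj.
  case: (unliftP v j) => [k ->|->]; last by rewrite !insert_v.
  rewrite !insert_lift => eki.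
  have [kU2|/p2NU2-> //] := boolP (lift v k \in U2).
  by have := neq_lift v i; rewrite (from_U2 eki kU2 iU) eqxx.
apply: (connect_trans xp2 (connect_trans p2p3 _)).
have p2x : connect E p2 x.
  have p2A := trap_connect (attractor_trap attA) xA xp2.
  exact: attractor_connect attA p2A xA.
(* Replaying the path from [p2] to [x] on [U] alone keeps the flipped [i] and restores [U2]. *)
have := connect_mix (flip p2 i) closedU vU p2x.
rewrite !mix_flip // mix_id; suff -> : mix U x p2 = x by [].
apply/ffunP=> k; rewrite ffunE; case: ifP => // kU; apply: p2NU2.
by apply: contraFN kU => kU2; rewrite inE kU2 orbT.
Qed.

(** Admissibility is asked somewhere in [A'], not at [proj v x], because [v] may keep its value
    while the other components move. *)
Definition lift_attractor (A' : {set state n.-1}) : {set state n} :=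
  [set x | (proj v x \in A') && [exists y in A', admissible y (x v)]].

Lemma trap_lift_attractor A' :
  attractor (elim_network f v) A' -> trap_set f (lift_attractor A').
Proof.
move=> attA; have tA := attractor_trap attA.
apply/trap_setP=> x z; rewrite -(insert_proj x) inE insertK insert_v => /andP[].
move: (proj v x) (x v) => {}x w xA /exists_inP[y yA adm] /asyncP[j neq ->].
case: (unliftP v j) neq => [i ->|->]; rewrite ?insert_lift ?insert_v => neq.
  rewrite flip_insert_lift inE insertK insert_v; apply/andP; split; last first.
    by apply/exists_inP; exists y.
  apply: (trap_connect tA xA).
  (* Updates in [U] do not read [v], so they are transitions of the reduced network even if [w] is
     outdated. *)
  have [iU|iU] := boolP (lift v i \in U); last exact: connect_outdated yA adm iU neq.
  apply/connect1/async_elimP; exists i, (f (insert v false x) v).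
  rewrite admissible_f; split=> //; apply: contraNneq neq => <-.
  apply/eqP/eq_component => j' neqj s; apply: contra neqj => /closedU/(_ iU).
  case: (unliftP v j') => [k ->|->]; last by rewrite (negPf vU).
  by rewrite !insert_lift.
rewrite flip_insert_v inE insertK insert_v xA; apply/exists_inP; exists x => //.
apply/existsP; exists w; apply/eqP.
by case: w (f _ v) neq {adm} => [] [].
Qed.

Lemma attractor_elim_proj A A' y :
    attractor f A -> attractor (elim_network f v) A' ->
    y \in proj v @: A -> y \in A' ->
  proj v @: A = A'.
Proof.
move=> attA attA' yA yA'; have tA := attractor_trap attA.
have adm := admissible_f false y.
have zB : insert v (f (insert v false y) v) y \in lift_attractor A'.
  by rewrite inE insertK insert_v yA'; apply/exists_inP; exists y.
have := attractor_sub attA (trap_lift_attractor attA') (trap_admissible tA yA adm) zB.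
move=> /subsetP sAB; apply/eqP.
rewrite eqEsubset (attractor_sub attA' (trap_proj tA) yA' yA) andbT.
by apply/subsetP=> _ /imsetP[x /sAB + ->]; rewrite inE => /andP[].
Qed.

End Elimination.

Theorem theorem4p5 (n : nat) (f : state n -> state n)
  (U1 U2 W : {set 'I_n}) (v : 'I_n)
  (cover_V : U1 :|: U2 :|: W :|: [set v] = [set: 'I_n])
  (disjoint_V : [/\ [disjoint U1 & U2], [disjoint U1 & W], [disjoint U2 & W]
                  & v \notin U1 :|: U2 :|: W])
  (edges : forall (s : int) (j i : 'I_n), edge f s j i ->
     [|| (j \in U1) && (i \in U1), (j \in U2) && (i \in U2),
         (j \in W) && (i \in W),
         (j \in U1) && (i \in U2), (j \in U1) && (i \in W),
         (j \in U2) && (i == v), (j == v) && (i \in W)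
       | [&& j == v, i == v & s == (-1)%R]])
  (edge_U2_v : exists (s : int) (j : 'I_n), j \in U2 /\ edge f s j v)
  (edge_v_W : exists (s : int) (i : 'I_n), i \in W /\ edge f s v i) :
  (forall A : {set state n}, attractor f A ->
     attractor (elim_network f v) (proj v @: A)) /\
  (forall A' : {set state n.-1}, attractor (elim_network f v) A' ->
     exists! A : {set state n}, attractor f A /\ proj v @: A = A').
Proof.
(* The only loop allowed at [v] has sign -1. *)
have noloop : ~~ edge f 1%R v v.
  have [_ _ _] := disjoint_V; rewrite !inE !negb_or -!andbA => /and3P[v1 v2 vW].
  apply/negP=> /edges.
  by rewrite (negPf v1) (negPf v2) (negPf vW) eqxx.
have [disj12 disj1W disj2W vN] := disjoint_V.
have vU : v \notin U1 :|: U2 by apply: contra vN => vU; rewrite inE vU.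
have [v1 v2] : v \notin U1 /\ v \notin U2.
  by move: vU; rewrite inE negb_or => /andP[].
have vW : v \notin W by apply: contra vN => vW; rewrite inE vW orbT.
have N12 i : i \in U1 -> i \in U2 = false by apply: disjointFr.
have N1W i : i \in U1 -> i \in W = false by apply: disjointFr.
have N2W i : i \in U2 -> i \in W = false by apply: disjointFr.
have Nv1 i : i \in U1 -> i == v = false.
  by move=> i1; apply: contraNF v1 => /eqP<-.
have Nv2 i : i \in U2 -> i == v = false.
  by move=> i2; apply: contraNF v2 => /eqP<-.
have closedU1 s j i : edge f s j i -> i \in U1 -> j \in U1.
  move=> /edges + i1; rewrite i1 (N12 i) // (N1W i) // (Nv1 i) //.
  by rewrite !andbF !orbF andbT.
have closedU s j i : edge f s j i -> i \in U1 :|: U2 -> j \in U1 :|: U2.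
  move=> e; rewrite !inE => /orP[/(closedU1 _ _ _ e)-> //|i2].
  move/edges: e; rewrite i2 (N2W i) // (Nv2 i) //.
  by case: (j \in U1); case: (j \in U2); rewrite ?andbF.
have into_v s j : edge f s j v -> j \in U2 \/ j = v.
  move=> /edges; rewrite (negPf v1) (negPf v2) (negPf vW) eqxx !andbF !andbT /=.
  by case/orP=> [|/andP[/eqP]]; [left | right].
have from_U2 s j i : edge f s j i -> j \in U2 -> i \notin U1 :|: U2 -> i = v.
  move=> /edges + j2; rewrite inE negb_or => + /andP[i1 i2].
  have j1 : j \in U1 = false by apply: contraTF j2 => /N12->.
  rewrite j1 (negPf i2) (N2W j) // (Nv2 j) // j2 /= orbF.
  by move/eqP.
have projE := attractor_elim_proj noloop vU disj12 closedU1 closedU into_v from_U2.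
split=> [A attA|A' attA'].
  (* The projection of [A] is a trap set, hence contains an attractor, to which it must be equal. *)
  have [x xA] := attractor_nonempty attA.
  have tA := trap_proj noloop (attractor_trap attA).
  have [A' attA' /subsetP sub] := attractor_exists tA (imset_f (proj v) xA).
  have [y yA'] := attractor_nonempty attA'.
  by rewrite (projE A A' y attA attA' (sub y yA') yA').
have [y yA'] := attractor_nonempty attA'.
(* Existence: any attractor of [f] inside the nonempty trap set over [A'] projects onto [A']. *)
have tB : trap_set f (lift_attractor f v A').
  exact: trap_lift_attractor vU disj12 closedU1 closedU into_v from_U2 _ attA'.
have zB : insert v (f (insert v false y) v) y \in lift_attractor f v A'.
  by rewrite inE insertK insert_v yA'; apply/exists_inP; exists y; rewrite ?admissible_f.
have [A attA /subsetP sub] := attractor_exists tB zB.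
have [x xA] := attractor_nonempty attA.
have xA' : proj v x \in A' by have := sub x xA; rewrite inE => /andP[].
have pA := projE A A' _ attA attA' (imset_f _ xA) xA'.
exists A; split=> [//|B [attB pB]].
by apply: (attractor_proj_inj noloop attA attB); rewrite pA pB.
Qed.
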